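(* For every natural number $n$, $$\bar{\tau}(K_n)=\sum_{k=1}^{n}\mathrm{Surj}(n,k)=\sum_{k=1}^{n}S(n,k)\,k!\qquad\text{and}\qquad \hbar(K_n)=2^{n-1},$$ where $\mathrm{Surj}(n,k)$ is the number of surjections from $\{1,\dots,n\}$ onto $\{1,\dots,k\}$ and $S(n,k)$ is the Stirling number of the second kind (the number of partitions of $\{1,\dots,n\}$ into exactly $k$ nonempty blocks).
   Context: $K_n$ is the complete graph on $n$ vertices. For a topology $\mathcal{T}$ on a finite set $X$, its underlying graph is the simple graph on $X$ in which distinct $x,y$ are adjacent iff $x\in\overline{\{y\}}$ or $y\in\overline{\{x\}}$ (closures in $\mathcal{T}$). For a finite simple graph $G$, $\bar{\tau}(G)$ is the number of topologies on $V(G)$ whose underlying graph is exactly $G$, and $\hbar(G)$ is the number of pairwise non-homeomorphic such topologies. *)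

(* Defs.v *)
From mathcomp Require Import all_boot all_fingroup.

Set Implicit Arguments.
Unset Strict Implicit.
Unset Printing Implicit Defensive.

Record sgraph (T : finType) := SGraph {
  edge :> rel T;
  edge_sym : symmetric edge;
  edge_irrefl : irreflexive edge
}.

Definition same_graph (T : finType) (G H : sgraph T) : bool :=
  [forall x, forall y, edge G x y == edge H x y].

Definition complete_edge (n : nat) : rel 'I_n := fun x y => x != y.

Lemma complete_edge_sym n : symmetric (@complete_edge n).
Proof. by move=> x y; rewrite /complete_edge eq_sym. Qed.

Lemma complete_edge_irrefl n : irreflexive (@complete_edge n).
Proof. by move=> x; rewrite /complete_edge eqxx. Qed.

Definition complete_graph (n : nat) : sgraph 'I_n :=
  SGraph (@complete_edge_sym n) (@complete_edge_irrefl n).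

(* A topology is represented by its set of open sets.  Here [cover F] is the
   union of the family [F]. *)
Definition is_topology (T : finType) (tau : {set {set T}}) : bool :=
  [&& set0 \in tau,
      [set: T] \in tau,
      [forall F : {set {set T}}, (F \subset tau) ==> (cover F \in tau)] &
      [forall A in tau, forall B in tau, A :&: B \in tau]].

Definition closure (T : finType) (tau : {set {set T}}) (A : {set T}) : {set T} :=
  \bigcap_(C : {set T} | (~: C \in tau) && (A \subset C)) C.

Definition underlying_edge (T : finType) (tau : {set {set T}}) : rel T :=
  fun x y => (x != y) &&
    ((x \in closure tau [set y]) || (y \in closure tau [set x])).

Lemma underlying_edge_sym (T : finType) (tau : {set {set T}}) :
  symmetric (underlying_edge tau).
Proof. by move=> x y; rewrite /underlying_edge eq_sym orbC. Qed.

Lemma underlying_edge_irrefl (T : finType) (tau : {set {set T}}) :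
  irreflexive (underlying_edge tau).
Proof. by move=> x; rewrite /underlying_edge eqxx. Qed.

Definition underlying_graph (T : finType) (tau : {set {set T}}) : sgraph T :=
  SGraph (@underlying_edge_sym T tau) (@underlying_edge_irrefl T tau).

Definition topologies_on (T : finType) (G : sgraph T) : {set {set {set T}}} :=
  [set tau | is_topology tau & same_graph (underlying_graph tau) G].

Definition tau_bar (T : finType) (G : sgraph T) : nat := #|topologies_on G|.

Definition continuous_map (T U : finType) (tau : {set {set T}})
    (sigma : {set {set U}}) (f : T -> U) : bool :=
  [forall A in sigma, f @^-1: A \in tau].

Definition homeomorphic (T : finType) : rel {set {set T}} :=
  fun tau sigma => [exists f : {perm T},
    continuous_map tau sigma f && continuous_map sigma tau (f^-1)%g].

(* [equivalence_partition] is the quotient only for an equivalence relation,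
   whence this lemma. *)
Lemma homeomorphic_equivalence (T : finType) :
  equivalence_rel (@homeomorphic T).
Proof.
have refl (tau : {set {set T}}) : homeomorphic tau tau.
  apply/existsP; exists 1%g; rewrite invg1 andbb; apply/forall_inP => A A_tau.
  suff -> : (1%g : {perm T}) @^-1: A = A by [].
  by apply/setP => x; rewrite inE perm1.
have sym (tau sigma : {set {set T}}) : homeomorphic tau sigma -> homeomorphic sigma tau.
  by case/existsP=> f fP; apply/existsP; exists f^-1%g; rewrite invgK andbC.
have cont_comp (t1 t2 t3 : {set {set T}}) (f g : {perm T}) :
    continuous_map t1 t2 f -> continuous_map t2 t3 g ->
    continuous_map t1 t3 (f * g)%g.
  move=> /forall_inP cf /forall_inP cg; apply/forall_inP => A /cg /cf.
  suff -> : (f * g)%g @^-1: A = f @^-1: (g @^-1: A) by [].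
  by apply/setP => x; rewrite !inE permM.
have trans : transitive (@homeomorphic T).
  move=> t2 t1 t3 /existsP[f /andP[f1 f2]] /existsP[g /andP[g1 g2]].
  apply/existsP; exists (f * g)%g; rewrite invMg.
  by rewrite (cont_comp _ _ _ _ _ f1 g1) (cont_comp _ _ _ _ _ g2 f2).
move=> t1 t2 t3; split=> [|h12]; first exact: refl.
by apply/idP/idP; apply: trans => //; apply: sym.
Qed.

Definition hbar (T : finType) (G : sgraph T) : nat :=
  #|equivalence_partition (@homeomorphic T) (topologies_on G)|.

Definition surj (n k : nat) : nat :=
  #|[set f : {ffun 'I_n -> 'I_k} | [forall y, exists x, f x == y]]|.

(* In the library's [partition] the blocks are nonempty. *)
Definition stirling2 (n k : nat) : nat :=
  #|[set P : {set {set 'I_n}} | partition P [set: 'I_n] & #|P| == k]|.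

(* Main.v *)
(* The topologies with underlying graph [K_n] are exactly the chains of subsets
   of ['I_n] containing [set0] and the whole set.  A chain with [k + 1] members
   is the chain of sublevel sets [f < i] of a unique surjection [f] onto
   ['I_k].  Two such chains are homeomorphic iff their members have the same
   cardinalities, and the sets of cardinalities that occur are the subsets of
   [{0, .., n}] containing [0] and [n].  Finally, the surjections with a given
   kernel partition into [k] blocks form a free orbit of ['S_k]. *)
Require Import Defs.
From mathcomp Require Import all_boot all_fingroup.

Set Implicit Arguments.
Unset Strict Implicit.
Unset Printing Implicit Defensive.

(** * General counting lemmas *)

Lemma card_equivalence_partition (T U : finType) (R : rel T) (h : T -> U)
    (D : {set T}) :
  {in D &, forall x y, R x y = (h x == h y)} ->
  #|equivalence_partition R D| = #|h @: D|.
Proof.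
move=> Rh; pose block u := [set y in D | h y == u].
(* The blocks are the fibres of [h] in [D], and a nonempty fibre determines its value. *)
have -> : equivalence_partition R D = block @: (h @: D).
  rewrite -imset_comp; apply: eq_in_imset => x Dx /=.
  apply/setP => y; rewrite !inE; case Dy: (y \in D) => //=.
  by rewrite Rh // eq_sym.
rewrite card_in_imset // => _ v /imsetP[x Dx ->] _ /setP/(_ x).
by rewrite !inE Dx eqxx /= => /esym/eqP.
Qed.

Lemma card_supersets (T : finType) (X : {set T}) :
  #|[set S : {set T} | X \subset S]| = 2 ^ (#|T| - #|X|).
Proof.
have -> : #|T| - #|X| = #|~: X| by rewrite [RHS]cardsCs setCK.
rewrite -card_powerset.
have injU : {in powerset (~: X) &, injective (setU X)}.
  suff keyU (S : {set T}) : S \in powerset (~: X) -> (X :|: S) :\: X = S.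
    by move=> S1 S2 /keyU {2}<- /keyU {2}<- ->.
  rewrite inE => /subsetP sSX; apply/setP => x; rewrite !inE.
  by case Sx: (x \in S); move/(_ x): sSX; rewrite !inE Sx;
     case: (x \in X) => // /(_ isT).
rewrite -(card_in_imset injU); apply: eq_card => S; rewrite inE; apply/idP/imsetP => [sXS | [S' _ ->]]; last exact: subsetUl.
exists (S :\: X); first by rewrite inE setDE subsetIr.
by apply/setP => x; rewrite !inE; case Xx: (x \in X) => //=; rewrite (subsetP sXS).
Qed.

Lemma card_ord_ltn n i : i <= n -> #|[set j : 'I_n | j < i]| = i.
Proof.
move=> le_in; rewrite -[RHS]card_ord -cardsT.
have inj_w : injective (widen_ord le_in) by move=> a b /(congr1 val) /= /val_inj.
rewrite -(card_imset _ inj_w); apply: eq_card => j; rewrite inE.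
apply/idP/imsetP => [lt_ji | [j' _ ->]]; last exact: (ltn_ord j').
by exists (Ordinal lt_ji) => //; apply: val_inj.
Qed.

(** * Surjections and Stirling numbers *)

Lemma surjP n k (f : {ffun 'I_n -> 'I_k}) :
  reflect (forall y, exists x, f x = y)
    (f \in [set f : {ffun 'I_n -> 'I_k} | [forall y, exists x, f x == y]]).
Proof.
rewrite inE; apply: (iffP forallP) => f_surj y; have := f_surj y.
  by case/existsP=> x /eqP; exists x.
by case=> x fx; apply/existsP; exists x; apply/eqP.
Qed.

Lemma eq_preim_partitionP (T U : finType) (V : finType) (f : T -> U) (g : T -> V) :
  reflect (forall x y, (f x == f y) = (g x == g y))
    (preim_partition f [set: T] == preim_partition g [set: T]).
Proof.
have mem_pblock (W : finType) (h : T -> W) x y :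
    (y \in pblock (preim_partition h [set: T]) x) = (h x == h y).
  rewrite pblock_equivalence_partition ?inE // => a b c _ _ _.
  by split=> [|/eqP->]; rewrite /= ?eqxx.
apply: (iffP eqP) => [eq_fg x y | eq_fg]; first by rewrite -!mem_pblock eq_fg.
by apply: eq_imset => x; apply/setP=> y; rewrite !inE /= eq_fg.
Qed.

Lemma surj_fiber_card n k (f : {ffun 'I_n -> 'I_k}) :
  (forall y, exists x, f x = y) ->
  #|[set g : {ffun 'I_n -> 'I_k} | [forall y, exists x, g x == y] &
      preim_partition g [set: 'I_n] == preim_partition f [set: 'I_n]]| = k`!.
Proof.
move=> f_surj.
pose act (s : {perm 'I_k}) := [ffun x => s (f x)] : {ffun 'I_n -> 'I_k}.
have act_inj : injective act.
  move=> s t /ffunP eq_st; apply/permP=> y; have [x <-] := f_surj y.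
  by have := eq_st x; rewrite !ffunE.
rewrite -card_Sn -cardsT -(card_imset _ act_inj); apply: eq_card => g.
rewrite inE; apply/andP/imsetP => [[/forallP g_surj /eq_preim_partitionP eq_gf] | [s _ ->]].
  (* For a section [sec] of [f], equality of kernels makes [g] after [sec] injective, hence a
     permutation. It carries [f] to [g] because [x] and [sec (f x)] have the same image under [f],
     hence under [g]. *)
  have /fin_all_exists[sec secK] := f_surj.
  have s_inj : injective (fun y => g (sec y)).
    by move=> y z /eqP; rewrite eq_gf !secK => /eqP.
  exists (perm s_inj) => //; apply/ffunP=> x; rewrite ffunE permE; apply/eqP.
  by rewrite eq_gf secK.
split; last by apply/eq_preim_partitionP => x y; rewrite !ffunE (inj_eq perm_inj).
apply/forallP=> y; have [x fx] := f_surj (s^-1%g y); apply/existsP; exists x.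
by rewrite ffunE fx permKV.
Qed.

Lemma surj_stirling2 n k : surj n k = stirling2 n k * k`!.
Proof.
rewrite /surj /stirling2 -sum1_card.
pose parts := [set P : {set {set 'I_n}} | partition P [set: 'I_n] & #|P| == k].
rewrite (partition_big (fun f : {ffun 'I_n -> 'I_k} => preim_partition f [set: 'I_n])
   (mem parts)) /=; last first.
  move=> f /surjP f_surj; rewrite inE preim_partitionP /=.
  rewrite (card_equivalence_partition (h := f)) //.
  rewrite -[X in _ == X]card_ord -cardsT; apply/eqP/eq_card => y; rewrite inE.
  by have [x <-] := f_surj y; rewrite imset_f.
rewrite -sum_nat_const; apply: eq_bigr => P; rewrite inE => /andP[partP /eqP cardP].
(* A representative surjection with kernel [P] sends each point to the rank of its block in
   [enum P]. *)
have P_lt x : index (pblock P x) (enum P) < k.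
  rewrite -cardP cardE index_mem mem_enum pblock_mem //.
  by rewrite (cover_partition partP) inE.
pose f := [ffun x => Ordinal (P_lt x)].
have ker_f x y : (f x == f y) = (pblock P x == pblock P y).
  rewrite !ffunE -val_eqE /=; apply/eqP/eqP => [|-> //].
  apply: (index_inj set0); rewrite mem_enum pblock_mem //.
    by rewrite (cover_partition partP) inE.
  by rewrite (cover_partition partP) inE.
have Pf : preim_partition f [set: 'I_n] = P.
  by rewrite -[RHS](preim_partition_pblock partP); apply/eqP/eq_preim_partitionP.
have f_surj y : exists x, f x = y.
  (* Surjectivity follows by counting: the image of [f] has as many elements as its kernel has
     blocks, namely [k]. *)
  suff : y \in f @: [set: 'I_n] by case/imsetP=> x _ ->; exists x.
  suff -> : f @: [set: 'I_n] = [set: 'I_k] by rewrite inE.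
  apply/eqP; rewrite eqEcard subsetT cardsT card_ord.
  have <- : #|preim_partition f [set: 'I_n]| = #|f @: [set: 'I_n]|.
    exact: card_equivalence_partition.
  by rewrite Pf cardP leqnn.
rewrite -(surj_fiber_card f_surj) -sum1_card.
by apply: eq_bigl => g; rewrite !inE Pf.
Qed.

(** * Chains as topologies of the complete graph *)

Definition full_chain (T : finType) (C : {set {set T}}) : bool :=
  [&& set0 \in C, [set: T] \in C &
      [forall A in C, forall B in C, (A \subset B) || (B \subset A)]].

Lemma full_chainP (T : finType) (C : {set {set T}}) :
  reflect [/\ set0 \in C, [set: T] \in C &
    forall A B, A \in C -> B \in C -> (A \subset B) || (B \subset A)]
    (full_chain C).
Proof.
apply: (iffP and3P) => -[C0 CT chainC]; split=> //.
  by move=> A B CA CB; move/forall_inP/(_ A CA)/forall_inP/(_ B CB): chainC.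
by apply/forall_inP=> A CA; apply/forall_inP=> B CB; apply: chainC.
Qed.

Lemma closure1P (T : finType) (tau : {set {set T}}) x y :
  reflect (forall A, A \in tau -> y \in A -> x \in A) (y \in Defs.closure tau [set x]).
Proof.
apply: (iffP bigcapP) => [clos A tauA Ay | opn C /andP[tauC]].
  apply: contraLR Ay => nAx; rewrite -in_setC; apply: clos.
  by rewrite setCK tauA sub1set inE.
by rewrite sub1set => Cx; apply: contraLR Cx; rewrite -!in_setC; apply: opn.
Qed.

(** A nonempty finite chain has its member of greatest cardinality as union; the empty family gives
    [set0]. *)
Lemma cover_mem_chain (T : finType) (C F : {set {set T}}) :
  full_chain C -> F \subset C -> cover F \in C.
Proof.
move=> /full_chainP[C0 _ chainC] /subsetP sFC.
have [-> | [A0 FA0]] := set_0Vmem F; first by rewrite /cover big_set0.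
case: (arg_maxnP (fun A : {set T} => #|A|) FA0) => A FA maxA.
suff -> : cover F = A by apply: sFC.
apply/eqP; rewrite eqEsubset bigcup_sup // andbT; apply/bigcupsP=> B FB.
have /orP[|sAB] := chainC B A (sFC _ FB) (sFC _ FA); first by [].
suff /eqP-> : A == B by [].
by rewrite eqEcard sAB; apply: maxA.
Qed.

(* If neither of two open sets contained the other, points of their two
   differences would be non-adjacent. *)
Lemma topologies_on_complete_graph n :
  topologies_on (complete_graph n) = [set C | full_chain C].
Proof.
apply/setP=> C; rewrite !inE; apply/andP/idP.
  move=> [/and4P[C0 CT _ _] /forallP sameC]; apply/full_chainP; split=> // A B CA CB.
  apply/norP=> -[/subsetPn[a Aa nBa] /subsetPn[b Bb nAb]].
  have neq_ab : a != b by apply: contraNneq nBa => ->.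
  have /forallP/(_ b)/eqP := sameC a.
  rewrite /= /underlying_edge /complete_edge neq_ab /= => /orP[] /closure1P clos.
    by rewrite (clos A) in nAb.
  by rewrite (clos B) in nBa.
move=> fullC; have /full_chainP[C0 CT chainC] := fullC; split.
  rewrite /is_topology C0 CT /=; apply/andP; split.
    by apply/forallP=> F; apply/implyP; apply: cover_mem_chain.
  apply/forall_inP=> A CA; apply/forall_inP=> B CB.
  by case/orP: (chainC A B CA CB) => [/setIidPl|/setIidPr] ->.
apply/forallP=> x; apply/forallP=> y; rewrite /= /underlying_edge /complete_edge.
case: (eqVneq x y) => //= _; apply/eqP.
apply: contraT => /norP[nclx ncly].
(* Conversely, non-adjacent distinct points would each lie in a member of [C] that misses the other,
   and these two members would be incomparable. *)
have sep u v : u \notin Defs.closure C [set v] -> exists2 A, A \in C & (u \in A) && (v \notin A).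
  move=> nclu; apply/exists_inP; apply: contraR nclu => /exists_inPn noA.
  by apply/closure1P => A CA Au; have := noA A CA; rewrite Au /= negbK.
have [A CA /andP[Ax nAy]] := sep _ _ nclx; have [B CB /andP[By nBx]] := sep _ _ ncly.
have /orP[/subsetP sAB|/subsetP sBA] := chainC A B CA CB.
  by rewrite sAB in nBx.
by rewrite sBA in nAy.
Qed.

(** The number of members missing a point tells how late it enters the chain. A member without [x]
    cannot contain [A], so it lies in [A] and misses [y]; [A] itself makes the inequality strict. *)
Lemma full_chain_ltn (T : finType) (C : {set {set T}}) A x y :
  full_chain C -> A \in C -> x \in A -> y \notin A ->
  #|[set B in C | x \notin B]| < #|[set B in C | y \notin B]|.
Proof.
move=> /full_chainP[_ _ chainC] CA Ax nAy; apply/proper_card/properP; split.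
  apply/subsetP=> B; rewrite !inE => /andP[CB nBx]; rewrite CB /=.
  have /orP[/subsetP sAB | /subsetP sBA] := chainC A B CA CB.
    by rewrite sAB in nBx.
  by apply: contra nAy => /sBA.
by exists A; rewrite !inE CA ?Ax.
Qed.

(** * Chains as sublevel sets of surjections *)

Definition sublevels n k (f : {ffun 'I_n -> 'I_k}) : {set {set 'I_n}} :=
  [set [set x | f x < i] | i : 'I_k.+1].

Lemma sublevels_full_chain n k (f : {ffun 'I_n -> 'I_k}) : full_chain (sublevels f).
Proof.
apply/full_chainP; split.
- by apply/imsetP; exists ord0 => //; apply/setP=> x; rewrite !inE ltn0.
- by apply/imsetP; exists ord_max => //; apply/setP=> x; rewrite !inE ltn_ord.
move=> _ _ /imsetP[i _ ->] /imsetP[j _ ->].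
have sub (i1 i2 : 'I_k.+1) : i1 <= i2 -> [set x | f x < i1] \subset [set x | f x < i2].
  by move=> le12; apply/subsetP=> x; rewrite !inE => /leq_trans; apply.
by case/orP: (leq_total i j) => /sub ->; rewrite ?orbT.
Qed.

(** Consecutive sublevel sets differ by one fibre of [f], so all [k.+1] of them are distinct iff no
    fibre is empty. *)
Lemma card_sublevels n k (f : {ffun 'I_n -> 'I_k}) :
  (#|sublevels f| == k.+1) = [forall y, exists x, f x == y].
Proof.
rewrite -[X in _ == X]card_ord; apply/imset_injP/forallP => [inj_lev y | f_surj].
  apply: contraT => /existsPn nfy.
  suff /(inj_lev (widen_ord (leqnSn k) y) (lift ord0 y) isT isT)/(congr1 val)/eqP :
      [set x | f x < y] = [set x | f x < lift ord0 y].
    by rewrite /= /bump add1n ltn_eqF.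
  apply/setP=> x; rewrite !inE /= /bump /= add1n ltnS [RHS]leq_eqVlt.
  by rewrite val_eqE (negbTE (nfy x)).
have lt_neq (i j : 'I_k.+1) : i < j -> [set x | f x < i] <> [set x | f x < j].
  move=> lt_ij; have lt_ik : i < k by rewrite -ltnS (leq_trans _ (ltn_ord j)).
  have /existsP[x /eqP fx] := f_surj (Ordinal lt_ik).
  by move/setP/(_ x); rewrite !inE fx /= ltnn lt_ij.
move=> i j _ _ eq_ij; apply: val_inj.
by case: (ltngtP i j) => // [/lt_neq | /lt_neq /nesym].
Qed.

(** Exactly the thresholds 0 to [f x] give sets missing [x]. This recovers [f] from its chain. *)
Lemma card_compl_sublevels n k (f : {ffun 'I_n -> 'I_k}) x :
  #|sublevels f| = k.+1 -> #|[set A in sublevels f | x \notin A]| = (f x).+1.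
Proof.
move=> cardf.
have inj_lev : injective (fun i : 'I_k.+1 => [set x | f x < i]).
  have /imset_injP inj : #|sublevels f| == #|'I_k.+1| by rewrite cardf card_ord.
  by move=> i j; apply: inj.
rewrite -[RHS](@card_ord_ltn k.+1); last exact: ltnW (ltn_ord _).
rewrite -(card_imset _ inj_lev).
apply: eq_card => A; rewrite inE; apply/andP/imsetP => [[/imsetP[i _ ->]] | [i]].
  by rewrite inE -leqNgt => le_ifx; exists i; rewrite ?inE ?ltnS.
by rewrite !inE ltnS => le_ifx ->; rewrite imset_f // inE -leqNgt.
Qed.

Lemma card_chains_surj n k :
  #|[set C : {set {set 'I_n}} | full_chain C & #|C| == k.+1]| = surj n k.
Proof.
have inj_sub : {in [set f : {ffun 'I_n -> 'I_k} | [forall y, exists x, f x == y]] &,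
    injective (@sublevels n k)}.
  move=> f g; rewrite !inE -!card_sublevels => /eqP cardf /eqP cardg eq_fg.
  apply/ffunP=> x; apply/val_inj/succn_inj.
  by rewrite -!card_compl_sublevels ?eq_fg.
rewrite /surj -(card_in_imset inj_sub); apply: eq_card => C.
rewrite inE; apply/andP/imsetP => [[fullC /eqP cardC] | [f]]; last first.
  by rewrite inE -card_sublevels => cardf ->; rewrite sublevels_full_chain.
have [C0 CT chainC] := full_chainP _ fullC.
(* By [card_compl_sublevels] the only candidate is [f x = (r x).-1]. Since [set0] misses every point
   and the whole set none, [r x] lies between 1 and [k]. *)
pose r x := #|[set A in C | x \notin A]|.
have r_gt0 x : 0 < r x by apply/card_gt0P; exists set0; rewrite !inE C0.
have r_le x : (r x).-1 < k.
  rewrite prednK // -ltnS -cardC; apply/proper_card/properP; split.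
    by apply/subsetP=> A; rewrite inE => /andP[].
  by exists [set: 'I_n]; rewrite // !inE andbF.
pose f := [ffun x => Ordinal (r_le x)].
suff eqC : C = sublevels f.
  by exists f => //; rewrite inE -card_sublevels -eqC cardC.
apply/eqP; rewrite eqEcard cardC; apply/andP; split; last first.
  by apply: leq_trans (leq_imset_card _ _) _; rewrite card_ord.
(* The threshold cutting out [A] is the number of members strictly below it: these include all
   members missing a given point of [A], and a point outside [A] is missed by all of them and by
   [A]. *)
apply/subsetP=> A CA; pose pos := #|[set B in C | B \proper A]|.
have lt_pos : pos < k.+1.
  rewrite -cardC; apply/proper_card/properP; split.
    by apply/subsetP=> B; rewrite inE => /andP[].
  by exists A; rewrite // !inE properxx andbF.
apply/imsetP; exists (Ordinal lt_pos) => //; apply/setP=> x.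
rewrite inE ffunE /= prednK //; apply/idP/idP => [Ax | ].
  apply/subset_leq_card/subsetP=> B; rewrite !inE => /andP[CB nBx].
  rewrite CB properE; case/orP: (chainC A B CA CB) => [/subsetP/(_ x Ax) Bx | ->].
    by rewrite Bx in nBx.
  by apply: contra nBx => /subsetP->.
apply: contraLR => nAx; rewrite -ltnNge; apply/proper_card/properP; split.
  apply/subsetP=> B; rewrite !inE => /andP[-> /proper_sub/subsetP sBA] /=.
  by apply: contra nAx => /sBA.
by exists A; rewrite !inE CA ?properxx.
Qed.

(** * Homeomorphism classes and sets of cardinalities *)

(** [inord] is exact here, since a subset of ['I_n] has at most [n] elements. *)
Definition sizes n (C : {set {set 'I_n}}) : {set 'I_n.+1} :=
  [set inord #|A| | A : {set 'I_n} in C].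

Lemma mem_sizes n (C : {set {set 'I_n}}) (s : 'I_n.+1) :
  reflect (exists2 A, A \in C & #|A| = s) (s \in sizes C).
Proof.
have lt_card (A : {set 'I_n}) : #|A| < n.+1 by rewrite ltnS -[leqRHS]card_ord max_card.
apply: (iffP imsetP) => -[A CA].
  by move=> ->; exists A; rewrite // inordK.
by move=> cardA; exists A => //; apply: val_inj; rewrite /= inordK.
Qed.

(* [p] lists the points in the order in which they enter the members of the
   chain, ties being broken by the order of ['I_n]. *)
Lemma full_chain_straighten n (C : {set {set 'I_n}}) :
  full_chain C ->
  exists p : {perm 'I_n},
    forall A, A \in C -> A = p @^-1: [set i : 'I_n | i < #|A|].
Proof.
move=> fullC; pose r x := #|[set A in C | x \notin A]|.
pose lt (y x : 'I_n) := (r y < r x) || (r y == r x) && (y < x).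
have ltxx x : lt x x = false by rewrite /lt !ltnn andbF.
have lt_trans : transitive lt.
  move=> y x z /orP[xy | /andP[/eqP xy xy']] /orP[yz | /andP[/eqP yz yz']]; apply/orP.
  - by left; apply: ltn_trans xy yz.
  - by left; rewrite -yz.
  - by left; rewrite xy.
  - by right; rewrite xy yz eqxx (ltn_trans xy').
(* [q x] is the rank of [x] in the strict total order [lt]. *)
pose q x := #|[set y | lt y x]|.
have q_lt x y : lt x y -> q x < q y.
  move=> lt_xy; apply/proper_card/properP; split.
    by apply/subsetP=> z; rewrite !inE => /lt_trans; apply.
  by exists x; rewrite !inE ?ltxx.
have q_n x : q x < n.
  rewrite -[ltnRHS]card_ord -cardsT; apply/proper_card/properP; split.
    exact: subsetT.
  by exists x; rewrite !inE ?ltxx.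
have q_inj : injective (fun x => Ordinal (q_n x)).
  move=> x y /(congr1 val) /= eq_q; apply: val_inj.
  have nlt u v : q u = q v -> ~~ lt u v.
    by move=> eq_uv; apply/negP => /q_lt; rewrite eq_uv ltnn.
  have := nlt _ _ eq_q; have := nlt _ _ (esym eq_q); rewrite /lt.
  by case: ltngtP => //= _; case: ltngtP.
exists (perm q_inj) => A CA; apply/setP=> x; rewrite !inE permE /=.
(* Every point of [A] precedes every point outside it, so the points of [A] are those of rank below
   [#|A|]. *)
apply/idP/idP => [Ax | ].
  apply/proper_card/properP; split; last by exists x; rewrite // inE ltxx.
  apply/subsetP=> y; rewrite inE; apply: contraLR => nAy.
  by rewrite /lt; have := full_chain_ltn fullC CA Ax nAy; rewrite -/(r x) -/(r y); case: ltngtP.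
apply: contraLR => nAx; rewrite -leqNgt; apply/subset_leq_card/subsetP=> y Ay.
by rewrite inE /lt (full_chain_ltn fullC CA Ay nAx).
Qed.

(** Preimages under permutations keep cardinalities. Conversely, straightening both chains turns
    their members into initial segments of ['I_n], which are determined by their sizes; one
    straightening followed by the inverse of the other is a homeomorphism. *)
Lemma homeomorphic_full_chain n (C D : {set {set 'I_n}}) :
  full_chain C -> full_chain D -> homeomorphic C D = (sizes C == sizes D).
Proof.
move=> fullC fullD.
have sizes_sub (C1 C2 : {set {set 'I_n}}) (g : {perm 'I_n}) :
    continuous_map C1 C2 g -> sizes C2 \subset sizes C1.
  move=> /forall_inP contg; apply/subsetP=> s /mem_sizes[A CA cardA].
  apply/mem_sizes; exists (g @^-1: A); first exact: contg.
  by rewrite (card_preimset A (@perm_inj _ g)).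
apply/existsP/eqP => [[f /andP[cf cf1]] | eq_sizes].
  by apply/eqP; rewrite eqEsubset (sizes_sub _ _ _ cf) (sizes_sub _ _ _ cf1).
have [p pC] := full_chain_straighten fullC; have [q qD] := full_chain_straighten fullD.
have cont (C1 C2 : {set {set 'I_n}}) (p1 p2 : {perm 'I_n}) :
    (forall A, A \in C1 -> A = p1 @^-1: [set i : 'I_n | i < #|A|]) ->
    (forall A, A \in C2 -> A = p2 @^-1: [set i : 'I_n | i < #|A|]) ->
    sizes C2 \subset sizes C1 -> continuous_map C1 C2 (p1 * p2^-1)%g.
  move=> p1C p2C /subsetP sizes12; apply/forall_inP=> A CA.
  have : inord #|A| \in sizes C1 by apply: sizes12; apply: imset_f.
  case/mem_sizes=> B CB; rewrite inordK => [cardB|]; last first.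
    by rewrite ltnS -[leqRHS]card_ord max_card.
  suff -> : (p1 * p2^-1)%g @^-1: A = B by [].
  rewrite (p2C A CA) (p1C B CB) cardB; apply/setP=> x.
  by rewrite !inE permM permKV.
exists (p * q^-1)%g; rewrite invMg invgK.
by rewrite !cont // eq_sizes.
Qed.

Lemma sizes_full_chains n :
  @sizes n @: [set C : {set {set 'I_n}} | full_chain C] =
  [set S : {set 'I_n.+1} | [set ord0; ord_max] \subset S].
Proof.
apply/setP=> S; rewrite inE; apply/imsetP/idP => [[C] | ].
  rewrite inE => /full_chainP[C0 CT _] ->; rewrite subUset !sub1set.
  apply/andP; split; apply/mem_sizes; first by exists set0; rewrite ?cards0.
  by exists [set: 'I_n]; rewrite ?cardsT ?card_ord.
rewrite subUset !sub1set => /andP[S0 Sn].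
(* A chain realising [S] consists of the initial segments whose lengths lie in [S]. *)
pose seg (s : 'I_n.+1) := [set i : 'I_n | i < s].
have seg_card s : #|seg s| = s by rewrite card_ord_ltn // -ltnS.
exists (seg @: S).
  rewrite inE; apply/full_chainP; split.
  - by apply/imsetP; exists ord0 => //; apply/setP=> x; rewrite !inE.
  - by apply/imsetP; exists ord_max => //; apply/setP=> x; rewrite !inE ltn_ord.
  move=> _ _ /imsetP[i _ ->] /imsetP[j _ ->].
  have sub (i1 i2 : 'I_n.+1) : i1 <= i2 -> seg i1 \subset seg i2.
    by move=> le12; apply/subsetP=> x; rewrite !inE => /leq_trans; apply.
  by case/orP: (leq_total i j) => /sub ->; rewrite ?orbT.
apply/setP=> s; apply/idP/mem_sizes => [Ss | [_ /imsetP[t St ->]]].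
  by exists (seg s); rewrite ?imset_f.
by rewrite seg_card => /val_inj <-.
Qed.

(** * Assembling the counts *)

Lemma card_full_chain n (C : {set {set 'I_n}}) : full_chain C -> 0 < #|C| <= n.+1.
Proof.
case/full_chainP=> C0 _ chainC; apply/andP; split; first by apply/card_gt0P; exists set0.
rewrite -[leqRHS]card_ord -(@card_in_imset _ _ (fun A : {set 'I_n} => inord #|A| : 'I_n.+1)).
  exact: max_card.
(* Comparable sets of equal cardinality coincide, so cardinality is injective on a chain. *)
move=> A B CA CB /(congr1 val) /=.
rewrite !inordK ?ltnS; try by rewrite -[leqRHS]card_ord max_card.
move=> eqAB; case/orP: (chainC A B CA CB) => sub; last apply: esym.
  by apply/eqP; rewrite eqEcard sub eqAB leqnn.
by apply/eqP; rewrite eqEcard sub eqAB leqnn.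
Qed.

Lemma surj0 n : 0 < n -> surj n 0 = 0.
Proof.
by move=> n_gt0; apply: eq_card0 => f; case: (f (Ordinal n_gt0)).
Qed.

Theorem theorem4p3 (n : nat) (n_gt0 : 0 < n) :
  [/\ tau_bar (complete_graph n) = \sum_(1 <= k < n.+1) surj n k,
      \sum_(1 <= k < n.+1) surj n k = \sum_(1 <= k < n.+1) stirling2 n k * k`!
    & hbar (complete_graph n) = 2 ^ (n - 1)].
Proof.
rewrite /tau_bar /hbar topologies_on_complete_graph; split.
(* The vanishing term [k = 0] is added so that the index ranges over ['I_n.+1]. Chains are then
   sorted by [#|C|.-1], on which [inord] is exact by [card_full_chain]. *)
- have <- : \sum_(0 <= k < n.+1) surj n k = \sum_(1 <= k < n.+1) surj n k.
    by rewrite big_ltn // surj0.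
  rewrite big_mkord -sum1_card.
  rewrite (partition_big (fun C : {set {set 'I_n}} => inord #|C|.-1 : 'I_n.+1) predT) //=.
  apply: eq_bigr => k _; rewrite -card_chains_surj -sum1_card; apply: eq_bigl => C.
  rewrite !inE; case fullC: (full_chain C) => //=.
  have /andP[C_gt0 C_le] := card_full_chain fullC.
  by rewrite -val_eqE /= inordK ?prednK // -eqSS prednK.
- by apply: eq_bigr => k _; apply: surj_stirling2.
rewrite (card_equivalence_partition (h := @sizes n)); last first.
  by move=> C D; rewrite !inE; apply: homeomorphic_full_chain.
(* As [n > 0], [ord0] and [ord_max] are distinct, leaving [n.+1 - 2] free elements. *)
rewrite sizes_full_chains card_supersets card_ord cards2 -val_eqE /=.
by rewrite (ltn_eqF n_gt0) subSS.
Qed.
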